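(* Let $\mathcal{A}$ be a finite alphabet, $\mathcal{F}$ the free group over $\mathcal{A}$, and $k\ge 2$. Let $S\subseteq\mathcal{F}$ be strongly $k$-product-free. Then $\bar{d}(S)\le \frac{1}{k}$.
   Context: A subset $S$ of a semigroup is $\ell$-product-free ($\ell\ge2$) if there are no $x_1,\dots,x_\ell,y\in S$ (not necessarily distinct) with $x_1\cdots x_\ell=y$; it is strongly $k$-product-free if it is $\ell$-product-free for every $\ell$ with $2\le \ell\le k$. Every element $w\in\mathcal{F}$ is identified with its reduced word, and $|w|$ denotes the length of the reduced word. For $A\subseteq \mathcal{F}$ and $n\ge 1$, $A(n)=\{w\in A: |w|=n\}$ and $A_{\le n}=\{w\in A: |w|\le n\}$. The measure $\mu$ on $\mathcal{F}$ is defined by $\mu(\{w\}) = 1/|\mathcal{F}(|w|)| = \frac{1}{2|\mathcal{A}|(2|\mathcal{A}|-1)^{|w|-1}}$. The upper asymptotic density is $\bar{d}(A)=\limsup_{n\to\infty}\frac{\mu(A_{\le n})}{\mu(\mathcal{F}_{\le n})}$. *)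

(* Defs.v *)
From mathcomp Require Import all_boot all_order all_algebra.
From mathcomp Require Import all_classical all_reals all_analysis.
Set Implicit Arguments. Unset Strict Implicit. Unset Printing Implicit Defensive.
Import Order.TTheory GRing.Theory Num.Theory.

(* Free group over a finite alphabet A: elements are reduced words over the
   letters A x bool, where (a,true) is the generator a and (a,false) is a^-1. *)
Section FreeGroup.
Variable A : finType.

Definition letter := (A * bool)%type.
Definition linv (x : letter) : letter := (x.1, ~~ x.2).

Definition reduced (w : seq letter) : bool :=
  sorted (fun x y => y != linv x) w.

Definition cons_red (x : letter) (w : seq letter) : seq letter :=
  if w is y :: w' then (if y == linv x then w' else x :: w) else [:: x].
Definition reduce (s : seq letter) : seq letter := foldr cons_red [::] s.

Definition fprod (ws : seq (seq letter)) : seq letter := reduce (flatten ws).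

(* S (a subset of F, given by its characteristic predicate on reduced words)
   is l-product-free *)
Definition lprod_free (l : nat) (S : pred (seq letter)) : Prop :=
  ~ exists (xs : seq (seq letter)) (y : seq letter),
      [/\ size xs = l, all S xs, S y & fprod xs = y].

Definition strongly_prod_free (k : nat) (S : pred (seq letter)) : Prop :=
  forall l, 2 <= l <= k -> lprod_free l S.

Fixpoint all_words (n : nat) : seq (seq letter) :=
  if n is m.+1 then [seq x :: w | x <- enum {: letter}, w <- all_words m]
  else [:: [::]].

Definition Fn (n : nat) : seq (seq letter) := seq.filter reduced (all_words n).

Local Open Scope ring_scope.
(* mu(S_{<= n}) = sum_{m <= n} |S(m)| / |F(m)|  (mu({w}) = 1/|F(|w|)|) *)
Definition mu_le (R : realType) (S : pred (seq letter)) (n : nat) : R :=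
  \sum_(m < n.+1) ((count S (Fn m))%:R / (size (Fn m))%:R).

Definition upper_density (R : realType) (S : pred (seq letter)) : \bar R :=
  limn_esup (fun n => (mu_le R S n / mu_le R predT n)%:E).
End FreeGroup.

(* Main.v *)
(* Replace the upper density by a Banach limit L of the proportions of S on spheres, and let g(u) be
   the corresponding relative density of S in the cylinder of reduced words with prefix u; it is the
   average of its values on the children of u. Fix a first letter e and let M be the supremum of g
   over the words u starting with e. A cylinder with g(u) close to M has almost all of its
   descendants of density close to M, so if M > 0 there is t = u'r in S with r of prescribed length
   and g(u') as close to M as desired. Given a word w, taking r as long as w confines the
   cancellation in t w to r, so t w extends u' by boundedly many letters and still has density close
   to M. Iterating gives t_1, ..., t_(k-1) in S and words W_0, ..., W_(k-1) with
   W_i = t_(i+1) W_(i+1), all of density at least M - d and with the same last letter. If W_i v and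
   W_j v both belonged to S with i < j, then W_i v = t_(i+1) ... t_j (W_j v) would be a product of
   j - i + 1 <= k elements of S. Hence k (M - d) <= 1. *)
Require Import Defs.
From mathcomp Require Import all_boot all_order all_algebra.
From mathcomp Require Import all_classical all_reals all_analysis.
From mathcomp Require Import ring lra zify.
Set Implicit Arguments. Unset Strict Implicit. Unset Printing Implicit Defensive.
Import Order.TTheory GRing.Theory Num.Theory.
Import numFieldNormedType.Exports.


(** * Reduced words and cancellation *)

Section ReducedWords.
Variable A : finType.
Implicit Types (x y : letter A) (u v w : seq (letter A)).

Lemma linvK : involutive (@linv A).
Proof. by case=> a b; rewrite /linv /= negbK. Qed.

Lemma linv_neq x : linv x != x.
Proof. by case: x => a b; rewrite /linv xpair_eqE eqxx /= eqb_negLR /=; case: b. Qed.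

Lemma reduced_cons x w : reduced (x :: w) -> reduced w.
Proof. by case: w => //= y w /andP[]. Qed.

Lemma reduced_cat u x v :
  reduced (rcons u x ++ v) = reduced (rcons u x) && reduced (x :: v).
Proof. by case: u => [|y u]; rewrite /reduced /= ?cat_path ?last_rcons. Qed.

Lemma reduced_cons_cat x u v :
  reduced (x :: u ++ v) = reduced (x :: u) && reduced (last x u :: v).
Proof. by rewrite /reduced /= cat_path. Qed.

Lemma reduced_cons_red x w : reduced w -> reduced (cons_red x w).
Proof.
case: w => [|y w] //= yw; case: eqP => [_|/eqP neq]; first exact: path_sorted yw.
by rewrite /reduced /= neq.
Qed.

Lemma reduced_foldr_cons_red w s :
  reduced s -> reduced (foldr (@cons_red A) s w).
Proof. by move=> sR; elim: w => //= x w; exact: reduced_cons_red. Qed.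

Lemma reduced_reduce w : reduced (reduce w).
Proof. exact: reduced_foldr_cons_red. Qed.

Lemma reduce_id w : reduced w -> reduce w = w.
Proof.
rewrite /reduce; elim: w => //= x w IHw xw; rewrite IHw ?(reduced_cons xw) //.
by case: w xw {IHw} => //= y w /andP[/negPf-> _].
Qed.

Lemma reduce_catr u v : reduce (u ++ v) = reduce (u ++ reduce v).
Proof. by rewrite /reduce !foldr_cat -/(reduce (reduce v)) reduce_id ?reduced_reduce. Qed.

Lemma cons_redK x w : reduced w -> cons_red x (cons_red (linv x) w) = w.
Proof.
case: w => [|y w] /=; first by rewrite eqxx.
rewrite linvK; case: eqP => [->{y}|_ _]; last by rewrite /= eqxx.
by case: w => //= z w /andP[/negPf->].
Qed.

(** When [x] cancels the head of [v], the right side applies [cons_red (linv x)] and then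
    [cons_red x], which cancel by [cons_redK]. *)
Lemma foldr_cons_red x v s : reduced v -> reduced s ->
  foldr (@cons_red A) s (cons_red x v) = cons_red x (foldr (@cons_red A) s v).
Proof.
case: v => [|y v] //= _ sR; case: eqP => [->|//].
by rewrite cons_redK //; exact: reduced_foldr_cons_red.
Qed.

Lemma reduce_catl u v : reduce (u ++ v) = reduce (reduce u ++ v).
Proof.
rewrite /reduce !foldr_cat -/(reduce v).
have vR := reduced_reduce v; elim: u => //= x u ->.
by rewrite foldr_cons_red ?reduced_reduce.
Qed.

(** Each letter of [w] either removes the last letter of [r] or ends the cancellation for good; as
    [w] is no longer than [r], the prefix [v] is never reached. *)
Lemma reduce_cancel v r w : size w <= size r -> reduced (v ++ r) -> reduced w ->
  exists2 s, reduce (v ++ r ++ w) = v ++ s & size s <= size r + size w.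
Proof.
elim: w r => [|y w IHw] r.
  by move=> _ vr _; exists r; rewrite ?cats0 ?addn0 // reduce_id.
case/lastP: r => [|r x] //; rewrite size_rcons /= ltnS => wr vrx yw.
have [yx|yx] := eqVneq y (linv x); last first.
  exists (rcons r x ++ y :: w); last by rewrite size_cat size_rcons.
  rewrite reduce_id // catA -rcons_cat reduced_cat rcons_cat vrx.
  by rewrite /reduced /= yx.
have vr : reduced (v ++ r) by move: vrx; rewrite -rcons_cat -cats1 => /cat_sorted2[].
have [s s1 s2] := IHw r wr vr (reduced_cons yw).
exists s; last by apply: leq_trans s2 _; rewrite addSn addnS ltnW.
rewrite -s1 cat_rcons !catA [RHS]reduce_catr [LHS]reduce_catr; congr (reduce (_ ++ _)).
by rewrite yx /= cons_redK ?reduced_reduce // reduced_reduce.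
Qed.

(* In rank 1 the letters [c] and [d] both equal [e]; in higher rank two letters cannot exhaust the
   alphabet. *)
Lemma exists_letter_avoiding u v e c d :
  reduced (e :: u) -> reduced (e :: v) -> last e u = c -> last e v = d ->
  exists y, (y != linv c) && (y != linv d).
Proof.
move=> eu ev <- <-; apply/existsP; apply: contraPT isT => /existsPn noy.
have A1 : (#|A| <= 1)%N.
  have : (#|{: letter A}| <= 2)%N.
    apply: leq_trans (card_size [:: linv (last e u); linv (last e v)]).
    by apply/subset_leq_card/fintype.subsetP => y _; move: (noy y); rewrite !inE negb_and !negbK.
  by rewrite card_prod card_bool -[2%N]mul1n leq_pmul2r.
have lastE w x : reduced (x :: w) -> last x w = x.
  elim: w x => //= y w IHw x /andP[yx yw]; rewrite IHw //.
  case: x y yx {IHw yw} => [a b] [a' b']; rewrite (card_le1_eqP A1 a' a) //.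
  by rewrite /linv xpair_eqE eqxx /=; case: b b' => [] [].
by have := noy e; rewrite !lastE // eq_sym linv_neq.
Qed.
End ReducedWords.

Local Open Scope ring_scope.

(** * Banach limits from Cesaro means *)

Section BanachLimit.
Variable R : realType.
Implicit Types (a b : nat -> R) (L : (nat -> R) -> R).

Definition bounded_seq a := exists B, forall n, `|a n| <= B.

Record banach_limit L : Prop := BanachLimit {
  blimD : forall a b, bounded_seq a -> bounded_seq b ->
    L (fun n => a n + b n) = L a + L b;
  blimZ : forall x a, bounded_seq a -> L (fun n => x * a n) = x * L a;
  ler_blim : forall a b, bounded_seq a -> bounded_seq b ->
    (forall n, a n <= b n) -> L a <= L b;
  blim_cst : forall x, L (fun=> x) = x;
  blim_shift : forall a, bounded_seq a -> L (fun n => a n.+1) = L a }.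

Lemma bounded_seqD a b :
  bounded_seq a -> bounded_seq b -> bounded_seq (fun n => a n + b n).
Proof.
move=> [B aB] [C bC]; exists (B + C) => n.
by rewrite (le_trans (ler_normD _ _)) // lerD.
Qed.

Lemma bounded_seqZ x a : bounded_seq a -> bounded_seq (fun n => x * a n).
Proof. by move=> [B aB]; exists (`|x| * B) => n; rewrite normrM ler_wpM2l. Qed.

Lemma bounded_seq_cst x : bounded_seq (fun=> x).
Proof. by exists `|x|. Qed.

Lemma bounded_seq01 a : (forall n, 0 <= a n <= 1) -> bounded_seq a.
Proof. by move=> a01; exists 1 => n; have /andP[a0 a1] := a01 n; rewrite ger0_norm. Qed.

Lemma bounded_seq_sum I (r : seq I) (P : pred I) (F : I -> nat -> R) :
  (forall i, bounded_seq (F i)) -> bounded_seq (fun n => \sum_(i <- r | P i) F i n).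
Proof.
move=> Fb; elim: r => [|i r IHr].
  by under eq_fun do rewrite big_nil; exact: bounded_seq_cst.
under eq_fun do rewrite big_cons.
by case: (P i) => //; apply: bounded_seqD.
Qed.

Lemma blim_sum L I (r : seq I) (P : pred I) (F : I -> nat -> R) :
  banach_limit L -> (forall i, bounded_seq (F i)) ->
  L (fun n => \sum_(i <- r | P i) F i n) = \sum_(i <- r | P i) L (F i).
Proof.
move=> Llim Fb; elim: r => [|i r IHr].
  by under eq_fun do rewrite big_nil; rewrite big_nil blim_cst.
under eq_fun do rewrite big_cons.
rewrite big_cons -IHr; case: (P i) => //; rewrite blimD //.
exact: bounded_seq_sum.
Qed.

Lemma blim_shiftn L a m : banach_limit L -> bounded_seq a ->
  L (fun n => a (m + n)%N) = L a.
Proof.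
move=> Llim ab; elim: m => [//|m IHm]; rewrite -IHm.
rewrite -[RHS]blim_shift //; last by case: ab => B aB; exists B.
by congr L; apply: funext => n; rewrite addSnnS.
Qed.

Definition cesaro a n : R := (\sum_(m < n.+1) a m) / n.+1%:R.

Lemma cesaro_le a B n : (forall m, `|a m| <= B) -> `|cesaro a n| <= B.
Proof.
move=> aB; rewrite /cesaro normrM normfV normr_nat ler_pdivrMr ?ltr0n //.
have : \sum_(i < n.+1) `|a i| <= \sum_(i < n.+1) B by apply: ler_sum.
by rewrite sumr_const card_ord mulr_natr; apply: le_trans (ler_norm_sum _ _ _).
Qed.

(** For bounded [a] the boundary term tends to 0, which makes limits of Cesaro means
    shift-invariant. *)
Lemma cesaro_shift a n :
  cesaro (fun m => a m.+1) n = cesaro a n + (a n.+1 - a 0%N) / n.+1%:R.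
Proof.
rewrite /cesaro -mulrDl; congr (_ / _).
rewrite big_ord_recr [in RHS]big_ord_recl /= -!/(bump _ _).
by under [in RHS]eq_bigr do rewrite /bump leq0n add1n; ring.
Qed.

(* The witness is the limit of the Cesaro means along a nonprincipal ultrafilter concentrated on
   the indices where the mean is at least [x]. *)
Lemma banach_limit_ge a x : bounded_seq a ->
  (forall N, exists2 n, (N <= n)%N & x <= cesaro a n) ->
  exists2 L, banach_limit L & x <= L a.
Proof.
move=> ab ax; pose D : set nat := [set n | x <= cesaro a n]%classic.
(* Properness holds because [D] meets every tail. *)
have FF : ProperFilter (within D \oo%classic).
  apply: Build_ProperFilter_ex => P [N _ NP].
  by have [n Nn xn] := ax N; exists n; exact: NP.
have [U [UU FU]] := ultraFilterLemma FF.
have UF : ProperFilter U := @ultra_proper _ U UU.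
have ooU : (\oo `<=` U)%classic by move=> P PN; apply/FU/(@cvg_within _ \oo%classic _ D).
have cvgU b : bounded_seq b -> cvg (cesaro b n @[n --> U])%classic.
  move=> [B bB].
  (* The means lie in a compact segment, so [U] has a cluster point [p]; an ultrafilter converges to
     its cluster points. *)
  have [|p [_ pU]] := @segment_compact R (- B) B (cesaro b @ U)%classic _.
    by apply: (@filterE _ U) => n; rewrite /= in_itv /= -ler_norml; exact: cesaro_le.
  apply/cvg_ex; exists p => V pV.
  have [//|UV] := in_ultra_setVsetC (cesaro b @^-1` V)%classic UU.
  by have [y []] := pU (~` V)%classic V UV pV.
exists (fun b => lim (cesaro b n @[n --> U])%classic).
  split.
  - move=> b c bb bc; apply/cvg_lim => //.
    rewrite (_ : cesaro _ = cesaro b + cesaro c); first exact: cvgD (cvgU b bb) (cvgU c bc).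
    by apply/funext => n; rewrite /cesaro big_split mulrDl.
  - move=> y b bb; apply/cvg_lim => //.
    rewrite (_ : cesaro _ = y \*: (cesaro b : _ -> R^o)); first exact: cvgZl_tmp (cvgU b bb).
    by apply/funext => n; rewrite /cesaro -big_distrr /= -mulrA.
  - move=> b c bb bc blec; apply: ler_lim; [exact: cvgU|exact: cvgU|].
    by apply: nearW => n; rewrite ler_pM2r ?invr_gt0 ?ltr0n // ler_sum.
  - move=> y; apply/cvg_lim => //; rewrite (_ : cesaro _ = cst y); first exact: cvg_cst.
    by apply/funext => n; rewrite /cesaro sumr_const card_ord -[y *+ _]mulr_natr mulfK ?pnatr_eq0.
  - move=> b bb; apply/cvg_lim => //.
    under eq_fun do rewrite cesaro_shift.
    rewrite -[lim (cesaro b n @[n --> U])%classic]addr0; apply: cvgD; first exact: cvgU.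
    suff : ((b n.+1 - b 0%N) / n.+1%:R @[n --> \oo] --> 0)%classic.
      by move=> h P /h; apply: ooU.
    case: bb => B bB.
    have hB x0 : (x0 * n.+1%:R^-1 @[n --> \oo] --> (0 : R))%classic.
      by rewrite -(mulr0 x0); apply: cvgM; [exact: cvg_cst|exact: cvg_harmonic].
    apply: (squeeze_cvgr _ (hB (- (B + B))) (hB (B + B))).
    apply: nearW => n; rewrite mulNr -ler_norml normrM normfV normr_nat.
    by rewrite ler_wpM2r ?invr_ge0 // (le_trans (ler_normB _ _)) // lerD.
apply: limr_ge; first exact: cvgU.
by apply: FU; apply: (@filterE _ \oo%classic).
Qed.
End BanachLimit.

(** * Averages over reduced continuations *)

Section LevelAverage.
Variables (R : realType) (A : finType).
Implicit Types (c y : letter A) (v : seq (letter A)) (H : seq (letter A) -> R).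

Definition branching := #|{: letter A}|.-1.
Local Notation q := (branching%:R : R).

Lemma card_follow c : #|[pred y | y != linv c]| = branching.
Proof. by rewrite (cardC1 (linv c)). Qed.

Lemma branching_gt0 c : (0 < branching)%N.
Proof. by rewrite -(card_follow c); apply/card_gt0P; exists c; rewrite inE eq_sym linv_neq. Qed.

Lemma branchingR_ge1 c : 1 <= q.
Proof. by rewrite ler1n (branching_gt0 c). Qed.

(** Uniform average over the reduced continuations of length [m] after the letter [c]: every letter
    has the same number [q] of successors, so nested averages weigh all words equally. *)
Fixpoint level_avg m c H : R :=
  if m is m'.+1 then
    (\sum_(y | y != linv c) level_avg m' y (fun v => H (y :: v))) / q
  else H [::].

Lemma level_avg_le m c H H' :
  (forall v, reduced (c :: v) -> size v = m -> H v <= H' v) ->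
  level_avg m c H <= level_avg m c H'.
Proof.
elim: m c H H' => [|m IHm] c H H' HH'; first exact: HH'.
rewrite /= ler_wpM2r ?invr_ge0 ?ler0n //; apply: ler_sum => y yc.
by apply: IHm => v yv mv; apply: HH'; rewrite /= ?mv // /reduced /= yc.
Qed.

Lemma eq_level_avg m c H H' :
  (forall v, reduced (c :: v) -> size v = m -> H v = H' v) ->
  level_avg m c H = level_avg m c H'.
Proof.
by move=> HH'; apply: le_anti; rewrite !level_avg_le // => v cv mv; rewrite HH'.
Qed.

Lemma level_avg_cst m c x : level_avg m c (fun=> x) = x.
Proof.
elim: m c => [//|m IHm] c /=; under eq_bigr do rewrite IHm.
rewrite sumr_const card_follow -[x *+ _]mulr_natr mulfK //.
by rewrite pnatr_eq0 -lt0n (branching_gt0 c).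
Qed.

Lemma level_avgZ m c x H : level_avg m c (fun v => x * H v) = x * level_avg m c H.
Proof.
elim: m c H => [//|m IHm] c H /=; under eq_bigr do rewrite IHm.
by rewrite -big_distrr /= mulrA.
Qed.

Lemma level_avg_sum I (r : seq I) m c (F : I -> seq (letter A) -> R) :
  level_avg m c (fun v => \sum_(i <- r) F i v) = \sum_(i <- r) level_avg m c (F i).
Proof.
elim: m c F => [//|m IHm] c F /=; under eq_bigr do rewrite IHm.
by rewrite exchange_big mulr_suml.
Qed.

Lemma level_avgD m c H H' :
  level_avg m c (fun v => H v + H' v) = level_avg m c H + level_avg m c H'.
Proof.
elim: m c H H' => [//|m IHm] c H H' /=; under eq_bigr do rewrite IHm.
by rewrite big_split mulrDl.
Qed.

Lemma level_avg_cat l m c H :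
  level_avg (l + m) c H =
  level_avg l c (fun v => level_avg m (last c v) (fun v' => H (v ++ v'))).
Proof. by elim: l c H => [//|l IHl] c H /=; under eq_bigr do rewrite IHl. Qed.

Lemma level_avg01 m c H :
  (forall v, 0 <= H v <= 1) -> 0 <= level_avg m c H <= 1.
Proof.
move=> H01; apply/andP; split.
  by rewrite -(level_avg_cst m c 0); apply: level_avg_le => v _ _; have /andP[] := H01 v.
by rewrite -[leRHS](level_avg_cst m c); apply: level_avg_le => v _ _; have /andP[] := H01 v.
Qed.

Lemma blim_level_avg L l c (F : seq (letter A) -> nat -> R) :
  banach_limit L -> (forall v, bounded_seq (F v)) ->
  L (fun n => level_avg l c (F^~ n)) = level_avg l c (fun v => L (F v)).
Proof.
move=> Llim; elim: l c F => [//|l IHl] c F Fb /=.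
have avgb y : bounded_seq (fun n => level_avg l y (fun v => F (y :: v) n)).
  elim: l y F Fb {IHl} => [|l IHl] y F Fb /=; first exact: Fb.
  under eq_fun do rewrite mulrC.
  by apply/bounded_seqZ/bounded_seq_sum => z; apply: (IHl z (fun v => F (y :: v))).
under eq_fun do rewrite mulrC.
rewrite blimZ ?blim_sum //; last by apply: bounded_seq_sum.
by rewrite mulrC; congr (_ / _); apply: eq_bigr => y _; rewrite IHl.
Qed.

Lemma count_level_avg (P : pred (seq (letter A))) m c :
  (count (fun v => P v && reduced (c :: v)) (all_words A m))%:R =
  q ^+ m * level_avg m c (fun v => (P v)%:R).
Proof.
elim: m c P => [|m IHm] c P; first by rewrite /= andbT addn0 mul1r.
rewrite -sum1_count big_mkcond big_allpairs_dep big_enum /= natr_sum (bigID (fun y => y == linv c)) /=.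
rewrite [X in X + _]big1 ?add0r => [|y yc]; last first.
  by rewrite big1 // => v _; rewrite /reduced /= yc andbF.
rewrite exprSr -mulrA [X in _ = _ * X]mulrC divfK ?pnatr_eq0 -?lt0n ?(branching_gt0 c) //.
rewrite big_distrr /=; apply: eq_bigr => y yc.
rewrite -IHm -big_mkcond /= sum1_count; congr _%:R; apply: eq_count => v.
by rewrite /reduced /= yc.
Qed.

Lemma count_Fn (P : pred (seq (letter A))) m :
  (count P (Fn A m.+1))%:R =
  q ^+ m * \sum_e level_avg m e (fun v => (P (e :: v))%:R).
Proof.
rewrite count_filter -sum1_count big_mkcond big_allpairs_dep big_enum /= natr_sum.
rewrite big_distrr /=; apply: eq_bigr => e _.
by rewrite -count_level_avg -big_mkcond /= sum1_count.
Qed.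
Lemma size_Fn_neq0 (e : letter A) m : (size (Fn A m))%:R != 0 :> R.
Proof.
case: m => [|m]; first by rewrite oner_eq0.
rewrite -count_predT count_Fn; under eq_bigr do rewrite level_avg_cst.
rewrite sumr_const mulf_neq0 ?expf_neq0 // pnatr_eq0 -lt0n ?(branching_gt0 e) //.
by apply/card_gt0P; exists e.
Qed.

Definition sphere_density (S : pred (seq (letter A))) m : R :=
  (count S (Fn A m))%:R / (size (Fn A m))%:R.

Lemma bounded_sphere_density S : bounded_seq (sphere_density S).
Proof.
apply: bounded_seq01 => m; rewrite /sphere_density divr_ge0 //=.
have [->|s0] := posnP (size (Fn A m)); first by rewrite invr0 mulr0.
by rewrite ler_pdivrMr ?ltr0n // mul1r ler_nat count_size.
Qed.

(** Once a letter exists every sphere has measure 1, so the denominator is [n.+1]. *)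
Lemma mu_le_ratio (e : letter A) S n :
  mu_le R S n / @mu_le A R predT n = cesaro (sphere_density S) n.
Proof.
congr (_ / _); rewrite /mu_le; under eq_bigr do rewrite count_predT divff ?size_Fn_neq0 //.
by rewrite sumr_const card_ord.
Qed.
End LevelAverage.

(** * Densities in cylinders *)

Section CylinderDensity.
Variables (R : realType) (A : finType) (S : pred (seq (letter A))).
Variables (L : (nat -> R) -> R) (Llim : banach_limit L) (e : letter A).
Implicit Types (u v w r : seq (letter A)).
Local Notation q := ((branching A)%:R : R).

(** The prefix is [e :: u], so that [last e u] is its actual last letter even when [u] is empty. *)
Definition cylinder_level u m : R :=
  level_avg m (last e u) (fun v => (S (e :: u ++ v))%:R).

Definition cylinder_density u := L (cylinder_level u).
Local Notation g := cylinder_density.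

Lemma cylinder_level01 u m : 0 <= cylinder_level u m <= 1.
Proof. by apply: level_avg01 => v; case: (S _); rewrite !lexx ler01. Qed.

Lemma bounded_cylinder_level u : bounded_seq (cylinder_level u).
Proof. exact: bounded_seq01 (cylinder_level01 u). Qed.
Hint Resolve bounded_cylinder_level : core.

Lemma cylinder_level_cat u l m :
  cylinder_level u (l + m) =
  level_avg l (last e u) (fun v => cylinder_level (u ++ v) m).
Proof.
rewrite /cylinder_level level_avg_cat; apply: eq_level_avg => v _ _.
by rewrite last_cat; apply: eq_level_avg => v' _ _; rewrite catA.
Qed.

(** Shift invariance skips the first [l] levels, and [L] commutes with finite averages. *)
Lemma cylinder_density_avg u l :
  g u = level_avg l (last e u) (fun v => g (u ++ v)).
Proof.
rewrite /g -(blim_shiftn l Llim) // -blim_level_avg //.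
by congr L; apply/funext => m; rewrite cylinder_level_cat.
Qed.

Let densities := [set g u | u in [set u | reduced (e :: u)]]%classic.
Definition max_density := sup densities.
Local Notation M := max_density.

Lemma has_sup_densities : has_sup densities.
Proof.
split; first by exists (g [::]), [::].
exists 1 => _ [u _ <-]; rewrite -(blim_cst Llim 1); apply: ler_blim => //.
  exact: bounded_seq_cst.
by move=> m; have /andP[] := cylinder_level01 u m.
Qed.

Lemma le_max_density u : reduced (e :: u) -> g u <= M.
Proof. by move=> eu; apply: sup_upper_bound has_sup_densities _ _; exists u. Qed.

Lemma max_density_adherent x : x < M -> exists2 u, reduced (e :: u) & x < g u.
Proof.
rewrite -subr_gt0 => /(sup_adherent)/(_ has_sup_densities)[_ [u eu <-]].
by rewrite opprB addrC subrK; exists u.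
Qed.

(* [M - g] is nonnegative, so the defect of a single child is at most the sum over all [q] children,
   which is [q] times the defect of the parent by [cylinder_density_avg]. *)
Lemma density_defect u v : reduced (e :: u ++ v) ->
  M - g (u ++ v) <= q ^+ size v * (M - g u).
Proof.
elim: v u => [|y v IHv] u; first by rewrite cats0 mul1r.
rewrite -cat_rcons => euyv; apply: le_trans (IHv _ euyv) _.
have /andP[euy _] : reduced (e :: rcons u y) && reduced (last e (rcons u y) :: v).
  by rewrite -reduced_cons_cat.
rewrite /= exprSr -mulrA ler_wpM2l ?exprn_ge0 //.
have [eu yc] : reduced (e :: u) /\ y != linv (last e u).
  by move: euy; rewrite /reduced /= rcons_path => /andP[].
have -> : q * (M - g u) = \sum_(z | z != linv (last e u)) (M - g (rcons u z)).
  rewrite (cylinder_density_avg u 1) /= sumrB sumr_const card_follow.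
  rewrite mulrBr mulr_natl mulrC divfK ?pnatr_eq0 -?lt0n ?(branching_gt0 e) //.
  by congr (_ - _); apply: eq_bigr => z _; rewrite cats1.
rewrite (bigD1 y) //= lerDl sumr_ge0 // => z /andP[zc _].
by rewrite subr_ge0 le_max_density // /reduced /= rcons_path zc andbT.
Qed.

(* If no such [u], [r] existed then, below a cylinder [u] of density close to [M], the set [S] would
   only be met below subcylinders with defect at least [d]; the proportion of these is at most
   [d^-1 (M - g u)], which is less than [g u]. *)
Lemma exists_dense_prefix l d : 0 < M -> 0 < d ->
  exists u r, [/\ reduced (e :: u), S (e :: u ++ r), size r = l & M - d < g u].
Proof.
move=> M0 d0.
(* The threshold is such that [M / (1 + d) < g u] amounts to [d^-1 * (M - g u) < g u]. *)
have [|u eu gu] := @max_density_adherent (M / (1 + d)).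
  by rewrite ltr_pdivrMr ?ltr_pMr //; lra.
apply: contrapT => nex; have d'0 : 0 <= d^-1 by rewrite invr_ge0 ltW.
have lvl n : cylinder_level u (l + n) <= d^-1 * (M - g u).
  rewrite addnC cylinder_level_cat (cylinder_density_avg u n).
  have -> : d^-1 * (M - level_avg n (last e u) (fun v => g (u ++ v))) =
            level_avg n (last e u) (fun v => d^-1 * (M + -1 * g (u ++ v))).
    by rewrite level_avgZ level_avgD level_avgZ level_avg_cst mulN1r.
  apply: level_avg_le => v uv vn; rewrite mulN1r.
  have euv : reduced (e :: u ++ v) by rewrite reduced_cons_cat eu.
  have [gv|gv] := ltP (M - d) (g (u ++ v)).
    apply: (@le_trans _ _ 0); last by rewrite mulr_ge0 // subr_ge0 le_max_density.
    rewrite -(level_avg_cst l (last e (u ++ v)) 0); apply: level_avg_le => r _ rl.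
    have [Sr|//] := boolP (S _).
    by case: nex; exists (u ++ v), r.
  apply: (@le_trans _ _ 1); first by have /andP[] := cylinder_level01 (u ++ v) l.
  by rewrite ler_pdivlMl // mulr1; lra.
have : g u <= d^-1 * (M - g u).
  rewrite -[leRHS](blim_cst Llim) -[leLHS](blim_shiftn l Llim) //.
  apply: ler_blim => //; last exact: bounded_seq_cst.
  by apply: bounded_seq01 => n; exact: cylinder_level01.
rewrite ler_pdivlMl //; move: gu; rewrite ltr_pdivrMr; lra.
Qed.

Hypothesis S_reduced : forall w, S w -> reduced w.

(* The words [W_i = reduce (flatten (drop i ts) ++ w)] satisfy [W_i = t_i W_(i+1)]. Since they all end
   with [c], the same words [v] extend all of them without cancellation, so that left translation
   by products of elements of [S] carries their cylinders onto one another. *)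
Lemma exists_dense_chain j d : 0 < M -> 0 < d ->
  exists ts w c, [/\ size ts = j, all S ts & forall i, (i <= j)%N ->
    exists u, [/\ reduce (flatten (drop i ts) ++ w) = e :: u, last e u = c & M - d < g u]].
Proof.
move=> M0; elim: j d => [|j IHj] d d0.
  have [|u eu gu] := @max_density_adherent (M - d); first lra.
  exists [::], (e :: u), (last e u); split=> // i _; exists u.
  by split=> //; exact: reduce_id.
have q1 : 1 <= q := branchingR_ge1 R e.
have q0 : 0 < q := lt_le_trans ltr01 q1.
(* One letter will be appended to every old word, which multiplies its defect by at most [q]. *)
have [|ts [w [c [tsj tsS chain]]]] := IHj (d / q); first by rewrite divr_gt0.
have [u0 [u0E u0c _]] := chain 0%N isT; rewrite drop0 in u0E.
(* The new word will extend [e :: u] by at most [l + l] letters after cancellation and one appended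
   letter, hence the exponent in [K]. *)
have eu0 : reduced (e :: u0) by rewrite -u0E reduced_reduce.
pose l := size (e :: u0); pose K := q ^+ (l + l).+1.
have K0 : 0 < K by rewrite exprn_gt0.
have [|u [r [eu St rl gu]]] := @exists_dense_prefix l (d / K) M0; first by rewrite divr_gt0.
have [|s sE sl] := @reduce_cancel _ (e :: u) r (e :: u0) _ (S_reduced St) eu0.
  by rewrite rl.
have eus : reduced (e :: u ++ s) by rewrite -[_ :: _]sE reduced_reduce.
(* [y] can follow both the old last letter [c] and the end of [e :: u ++ s], so it becomes the
   common last letter. *)
have [y /andP[yc yc']] := exists_letter_avoiding eu0 eus (erefl _) (erefl _).
exists ((e :: u ++ r) :: ts), (rcons w y), y; split=> /=; [by rewrite tsj|by rewrite St|].
have KE m : (m <= (l + l).+1)%N -> q ^+ m * (M - g u) < d.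
  move=> ml; apply: (@le_lt_trans _ _ (K * (M - g u))).
    by rewrite ler_wpM2r ?subr_ge0 ?le_max_density // ler_weXn2l.
  by rewrite mulrC -ltr_pdivlMr //; lra.
case=> [|i] ij.
  have E : reduce (flatten ((e :: u ++ r) :: ts) ++ rcons w y) = e :: u ++ rcons s y.
    have -> : flatten ((e :: u ++ r) :: ts) ++ rcons w y =
              ((e :: u) ++ r) ++ (flatten ts ++ w) ++ [:: y].
      by rewrite /= -cats1 -!catA.
    rewrite catA reduce_catl (reduce_catr _ (flatten ts ++ w)) u0E -!catA sE reduce_id.
      by rewrite /= -cats1 -catA.
    by rewrite !cat_cons reduced_cons_cat eus /reduced /= yc'.
  exists (u ++ rcons s y); split; first exact: E.
    by rewrite last_cat last_rcons.
  have : reduced (e :: u ++ rcons s y) by rewrite -E reduced_reduce.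
  move=> /density_defect h; suff: q ^+ size (rcons s y) * (M - g u) < d by lra.
  by rewrite KE // size_rcons ltnS (leq_trans sl) // rl.
have [ui [uiE uic gui]] := chain i ij.
have eui : reduced (e :: ui) by rewrite -uiE reduced_reduce.
have euiy : reduced (e :: ui ++ [:: y]).
  by rewrite reduced_cons_cat eui uic -u0c /reduced /= yc.
exists (ui ++ [:: y]); split; last 1 first.
- have := density_defect euiy; rewrite /= expr1 => h.
  suff: q * (M - g ui) < d by lra.
  by rewrite mulrC -ltr_pdivlMr //; lra.
- by rewrite -cats1 catA reduce_catl uiE reduce_id.
- by rewrite last_cat.
Qed.

Variable k : nat.
Hypothesis k2 : (2 <= k)%N.
Hypothesis S_free : strongly_prod_free k S.

Lemma chain_exclusive ts w v i j : all S ts -> (i < j <= size ts)%N -> (size ts < k)%N ->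
  reduced (reduce (flatten (drop i ts) ++ w) ++ v) ->
  reduced (reduce (flatten (drop j ts) ++ w) ++ v) ->
  S (reduce (flatten (drop i ts) ++ w) ++ v) ->
  S (reduce (flatten (drop j ts) ++ w) ++ v) -> False.
Proof.
set Wi := reduce (flatten (drop i ts) ++ w); set Wj := reduce (flatten (drop j ts) ++ w).
move=> tsS /andP[ij jts] tsk Wiv Wjv Si Sj.
pose p := take (j - i) (drop i ts).
have pE : drop i ts = p ++ drop j ts.
  by rewrite -{1}(cat_take_drop (j - i) (drop i ts)) drop_drop subnK // ltnW.
have ps : size p = (j - i)%N by rewrite size_take size_drop; case: ltnP; lia.
have pS : all S p.
  by apply/allP => t /mem_take/mem_drop; apply: (allP tsS).
(* The factors are the [j - i] words of [p] and then [Wj ++ v]; their number lies between 2 and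
   [k]. *)
apply: (@S_free (j - i).+1); first lia.
exists (rcons p (Wj ++ v)), (Wi ++ v); split=> //.
- by rewrite size_rcons ps.
- by rewrite all_rcons Sj.
rewrite /Defs.fprod flatten_rcons -[RHS]reduce_id // /Wi pE flatten_cat.
by rewrite reduce_catr /Wj -reduce_catl -reduce_catr -reduce_catl -!catA.
Qed.

(** A chain of length [k.-1] gives [k] words with the same continuations [v]; each [v] sends at most
    one of them into [S], so their densities sum to at most 1. *)
Lemma max_density_le : M <= k%:R^-1.
Proof.
have k0 : 0 < k%:R :> R by rewrite ltr0n ltnW.
have [M0|M0] := lerP M 0; first by rewrite (le_trans M0) // invr_ge0 ltW.
apply/ler_addgt0Pr => d d0.
have [ts [w [c [tsk tsS chain]]]] := exists_dense_chain k.-1 M0 d0.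
pose W i := reduce (flatten (drop i ts) ++ w).
have kE : k = k.-1.+1 by rewrite prednK // ltnW.
pose u (i : 'I_k) := behead (W i).
have uP (i : 'I_k) : [/\ W i = e :: u i, last e (u i) = c & M - d < g (u i)].
  have [|ui [uiE uic gui]] := chain i; first by rewrite -ltnS -kE.
  by rewrite /u /W uiE.
have exclusive m : \sum_(i < k) cylinder_level (u i) m <= 1.
  rewrite -[leRHS](level_avg_cst m c).
  have -> : \sum_(i < k) cylinder_level (u i) m =
      \sum_(i < k) level_avg m c (fun v => (S (e :: u i ++ v))%:R).
    by apply: eq_bigr => i _; have [_ <- _] := uP i.
  rewrite -level_avg_sum; apply: level_avg_le => v cv _.
  have WR (i : 'I_k) : reduced (W i ++ v).
    have [WE uc _] := uP i; rewrite WE cat_cons reduced_cons_cat uc cv andbT -WE.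
    exact: reduced_reduce.
  have [/existsP[i Si]|/existsPn none] := boolP [exists i : 'I_k, S (W i ++ v)]; last first.
    rewrite big1 // => i _; have := none i; have [-> _ _] := uP i.
    by rewrite /= => /negPf->.
  rewrite (bigD1 i) //= big1 ?addr0 => [|j ji].
    by case: (S _).
  have [WE _ _] := uP j; case: (boolP (S _)) => // Sj; exfalso.
  have {}Sj : S (W j ++ v) by rewrite WE.
  have [ij|ij|/ord_inj ij] := ltngtP i j; last by rewrite ij eqxx in ji.
  - by apply: (chain_exclusive tsS _ _ (WR i) (WR j)) => //; have := ltn_ord j; lia.
  - by apply: (chain_exclusive tsS _ _ (WR j) (WR i)) => //; have := ltn_ord i; lia.
have : \sum_(i < k) g (u i) <= 1.
  rewrite -blim_sum // -[leRHS](blim_cst Llim 1).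
  apply: ler_blim => //; [exact: bounded_seq_sum|exact: bounded_seq_cst].
have : \sum_(i < k) (M - d) <= \sum_(i < k) g (u i).
  by apply: ler_sum => i _; have [_ _ /ltW] := uP i.
rewrite sumr_const card_ord -[_ *+ k]mulr_natr => h1 h2.
by rewrite -lerBlDr -[leRHS]mul1r ler_pdivlMr // (le_trans h1).
Qed.
End CylinderDensity.

(** * From cylinders to the upper density *)

Lemma blim_sphere_density_le (R : realType) (A : finType) (S : pred (seq (letter A)))
    (L : (nat -> R) -> R) (k : nat) (e : letter A) :
  banach_limit L -> (2 <= k)%N -> (forall w, S w -> reduced w) -> strongly_prod_free k S ->
  L (sphere_density R S) <= k%:R^-1.
Proof.
move=> Llim k2 SR Sfree.
have N0 : 0 < #|{: letter A}|%:R :> R by rewrite ltr0n; apply/card_gt0P; exists e.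
have qN0 : (branching A)%:R != 0 :> R by rewrite pnatr_eq0 -lt0n (branching_gt0 e).
(* The shift skips the empty word; every later sphere splits by first letter into cylinders of equal
   size. *)
rewrite -blim_shift //; last exact: bounded_sphere_density.
have -> : (fun m => sphere_density R S m.+1) =
    (fun m => #|{: letter A}|%:R^-1 * \sum_x cylinder_level R S x [::] m).
  apply/funext => m; rewrite /sphere_density -count_predT !count_Fn.
  rewrite -mulf_div mulfV ?expf_neq0 // mul1r mulrC; congr (_^-1 * _).
  by under eq_bigr do rewrite level_avg_cst; rewrite sumr_const.
have lb x := bounded_cylinder_level R S x [::].
rewrite blimZ ?blim_sum //; last by apply: bounded_seq_sum.
rewrite mulrC ler_pdivrMr // mulr_natr -sumr_const; apply: ler_sum => x _.
apply: (@le_trans _ _ (max_density S L x)); first exact: le_max_density.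
exact: max_density_le.
Qed.

Lemma limn_esup_le (R : realType) (f : nat -> R) x N :
  (forall n, (N <= n)%N -> f n <= x) -> (limn_esup (fun n => (f n)%:E) <= x%:E)%E.
Proof.
move=> fx; apply: ge_ereal_inf; exists (ereal_sup ((fun n => (f n)%:E) @` [set n | N <= n]%N))%classic.
  by exists [set n | N <= n]%N%classic => //; exists N.
by apply: ge_ereal_sup => _ [n Nn <-]; rewrite lee_fin fx.
Qed.

Theorem theorem1p2 (R : realType) (A : finType) (k : nat) (S : pred (seq (letter A))) :
  (2 <= k)%N ->
  (forall w, S w -> reduced w) ->
  strongly_prod_free k S ->
  (upper_density R S <= (k%:R^-1 : R)%:E)%E.
Proof.
move=> k2 SR Sfree; apply/lee_addgt0Pr => d d0; rewrite -EFinD.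
have [e _|A0] := pickP {: letter A}; last first.
  (* Over an empty alphabet the only word is the empty one, which equals its square and so is not in
     [S]. *)
  apply: (@limn_esup_le _ _ _ 0%N) => n _.
  rewrite {1}/mu_le big1 ?mul0r ?addr_ge0 ?invr_ge0 ?(ltW d0) // => -[[|m] mn] _ /=.
    case: (boolP (S _)) => [S0|_]; last by rewrite mul0r.
    by case: (Sfree 2%N) => //; exists [:: [::]; [::]], [::]; rewrite /= S0.
  suff -> : Fn A m.+1 = [::] by rewrite mul0r.
  by rewrite /Fn /= (_ : enum _ = [::]) //; apply: size0nil; rewrite -cardE eq_card0.
apply: contrapT => notle.
(* If the bound fails, Cesaro means of at least [k%:R^-1 + d] occur at arbitrarily large indices,
   and some Banach limit is too large. *)
have [N|L Llim] := banach_limit_ge (x := k%:R^-1 + d) (bounded_sphere_density R S).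
  apply: contrapT => noN; apply/notle/(@limn_esup_le _ _ _ N) => n Nn.
  rewrite mu_le_ratio //; apply: contrapT => /negP; rewrite -ltNge => /ltW le_n.
  by apply: noN; exists n.
by rewrite leNgt (le_lt_trans (blim_sphere_density_le e Llim k2 SR Sfree)) // ltrDl.
Qed.
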